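(* Let $X\subset\mathbb{R}^s$ be open, let $f=(f_1,\dots,f_n):X\to\mathbb{R}^n$ and $g=(g_1,\dots,g_m):X\to\mathbb{R}^m$, and consider the problem (VP) of minimizing $f(x)$ subject to $g_i(x)\le 0$, $i=1,\dots,m$. Let $\bar x$ be a weak local minimizer of (VP) and let $d\in\mathbb{R}^s$ be a critical direction at $\bar x$. Suppose that: (i) the functions $g_i$, $i\notin I(\bar x)$, are continuous at $\bar x$; (ii) the functions $f_j$, $j=1,\dots,n$, and $g_i$, $i\in I(\bar x)$, are continuously differentiable; (iii) $f_j''(\bar x,d)$ exists whenever $\nabla f_j(\bar x)d=0$, and $g_i''(\bar x,d)$ exists whenever $i\in I(\bar x)$ and $\nabla g_i(\bar x)d=0$. Assume that the constraint qualification $\mathrm{cl}(A(\bar x,d))=B(\bar x,d)$ holds. Then there does not exist a vector $z\in\mathbb{R}^s$ such that $$\nabla f_j(\bar x)z+f_j''(\bar x,d)<0\quad\text{for all } j\in J(\bar x,d),$$ $$\nabla g_i(\bar x)z+g_i''(\bar x,d)\le 0\quad\text{for all } i\in K(\bar x,d).$$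
   Context: The feasible set is $S=\{x\in X\mid g_i(x)\le 0,\ i=1,\dots,m\}$, and for $x\in S$ the set of active constraints is $I(x)=\{i\in\{1,\dots,m\}\mid g_i(x)=0\}$. A point $\bar x\in S$ is a weak local minimizer of (VP) if there is a neighbourhood $U$ of $\bar x$ such that there is no $x\in U\cap S$ with $f_j(x)<f_j(\bar x)$ for all $j=1,\dots,n$. A direction $d\in\mathbb{R}^s$ is critical at $x\in S$ if $\nabla f_j(x)d\le 0$ for all $j\in\{1,\dots,n\}$ and $\nabla g_i(x)d\le 0$ for all $i\in I(x)$. $J(\bar x,d)=\{j\in\{1,\dots,n\}\mid \nabla f_j(\bar x)d=0\}$ and $K(\bar x,d)=\{i\in I(\bar x)\mid \nabla g_i(\bar x)d=0\}$. For $h:X\to\mathbb{R}$ Fréchet differentiable at $x$, the second-order directional derivative in direction $u\in\mathbb{R}^s$ is the (finite) limit, when it exists, $h''(x,u)=\lim_{t\to+0}2t^{-2}[h(x+tu)-h(x)-t\nabla h(x)u]\in\mathbb{R}$. For feasible $x$ and a direction $d$, $$A(x,d)=\{z\in\mathbb{R}^s\mid \forall i\in K(x,d)\ \exists\delta_i>0:\ g_i(x+td+\tfrac12t^2z)\le 0\ \ \forall t\in(0,\delta_i)\},$$ $$B(x,d)=\{z\in\mathbb{R}^s\mid \nabla g_i(x)z+g_i''(x,d)\le 0\ \text{for each } i\in K(x,d)\},$$ with $A(x,d)=B(x,d)=\mathbb{R}^s$ if $K(x,d)=\emptyset$. $\mathrm{cl}$ denotes closure. *)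

(* Defs.v *)
From HB Require Import structures.
From mathcomp Require Import all_boot all_order all_algebra.
From mathcomp Require Import all_classical all_reals all_analysis.

Set Implicit Arguments.
Unset Strict Implicit.
Unset Printing Implicit Defensive.

Import Order.TTheory GRing.Theory Num.Theory.
Import numFieldNormedType.Exports.

Local Open Scope classical_set_scope.
Local Open Scope ring_scope.

(* A function h : X -> R on an open set X of R^s is represented by a total
   function on 'rV[R]_s whose values outside X are irrelevant: they are never
   tested, and differentials and limits at a point of the open set X depend on
   the restriction to X only.  The product "nabla h(x) z" is 'd h x z. *)

Section SecondOrder.
Context {R : realType} {s : nat}.
Implicit Types (h : 'rV[R]_s -> R) (x u : 'rV[R]_s) (X : set 'rV[R]_s).

Definition gradient h x : 'rV[R]_s := \row_k 'd h x (delta_mx 0 k).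

Definition continuously_differentiable_on X h : Prop :=
  forall x, X x -> differentiable h x /\ {for x, continuous (gradient h)}.

Definition second_order_quotient h x u (t : R) : R :=
  2 * t ^- 2 * (h (x + t *: u) - h x - t * 'd h x u).

Definition has_second_dir_derivative h x u : Prop :=
  cvg (second_order_quotient h x u t @[t --> 0^'+]).

(* Meaningful only under has_second_dir_derivative h x u. *)
Definition second_dir_derivative h x u : R :=
  lim (second_order_quotient h x u t @[t --> 0^'+]).

End SecondOrder.

Section VectorProblem.
Context {R : realType} {s n m : nat}.
Variables (X : set 'rV[R]_s).
Variables (f : 'I_n -> 'rV[R]_s -> R) (g : 'I_m -> 'rV[R]_s -> R).
Implicit Types x d : 'rV[R]_s.

Definition feasible : set 'rV[R]_s :=
  [set x | X x /\ forall i, g i x <= 0].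

Definition active x : set 'I_m := [set i | g i x = 0].

Definition weak_local_minimizer x : Prop :=
  feasible x /\
  exists2 U : set 'rV[R]_s, nbhs x U &
    ~ exists2 y, (U `&` feasible) y & forall j, f j y < f j x.

Definition critical_direction x d : Prop :=
  (forall j, 'd (f j) x d <= 0) /\
  (forall i, active x i -> 'd (g i) x d <= 0).

Definition J_set x d : set 'I_n := [set j | 'd (f j) x d = 0].

Definition K_set x d : set 'I_m := [set i | active x i /\ 'd (g i) x d = 0].

(* Membership in X makes explicit that g i is evaluated inside its domain;
   for x in the open set X it holds for all small t anyway. *)
Definition A_set x d : set 'rV[R]_s :=
  [set z | forall i, K_set x d i ->
    exists2 delta : R, 0 < delta & forall t : R, 0 < t < delta ->
      let y := x + t *: d + (2^-1 * t ^+ 2) *: z in X y /\ g i y <= 0].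

Definition B_set x d : set 'rV[R]_s :=
  [set z | forall i, K_set x d i ->
    'd (g i) x z + second_dir_derivative (g i) x d <= 0].

End VectorProblem.

(* Main.v *)
(* A strict solution z of the f-inequalities lies in B = cl A, and the
   f-inequalities are open in z, so z may be moved into A.  Along the parabola
   x + t d + t^2/2 z every constraint then holds for small t > 0: by z in A on
   K, to first order on the other active indices, by continuity on the inactive
   ones.  Every f_j decreases strictly, to first order off J and to second
   order on J.  The second-order expansion along the parabola splits off
   h''(x, d) at the point x + t d; the remaining increment over t^2/2 tends to
   the differential at z by strict differentiability of C^1 functions. *)

Require Import Defs.
From HB Require Import structures.
From mathcomp Require Import all_boot all_order all_algebra.
From mathcomp Require Import all_classical all_reals all_analysis.

Set Implicit Arguments.
Unset Strict Implicit.
Unset Printing Implicit Defensive.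

Import Order.TTheory GRing.Theory Num.Theory.
Import numFieldNormedType.Exports.

Local Open Scope classical_set_scope.
Local Open Scope ring_scope.

(** * Joint continuity of differentials and strict differentiability *)

Lemma diff_gradientE (R : realType) (s : nat) (h : 'rV[R]_s -> R)
    (x v : 'rV[R]_s) :
  'd h x v = \sum_k gradient h x 0 k * v 0 k.
Proof.
rewrite {1}(row_sum_delta v) linear_sum; apply: eq_bigr => k _.
by rewrite linearZ mxE mulrC.
Qed.

(** In coordinates the differential is a finite sum of products of convergent factors. Both the base
    point and the direction may vary. *)
Lemma cvg_diff (R : realType) (s : nat) (h : 'rV[R]_s -> R) (x v : 'rV[R]_s)
    (T : Type) (F : set_system T) {FF : Filter F} (p w : T -> 'rV[R]_s) :
  {for x, continuous (gradient h)} -> p t @[t --> F] --> x ->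
  w t @[t --> F] --> v -> 'd h (p t) (w t) @[t --> F] --> 'd h x v.
Proof.
move=> gradc px wv.
have dE : (fun t => 'd h (p t) (w t)) =
    (fun t => \sum_k gradient h (p t) 0 k * w t 0 k).
  by apply/funext => t; exact: diff_gradientE.
have : \sum_k gradient h (p t) 0 k * w t 0 k @[t --> F] -->
    \sum_k gradient h x 0 k * v 0 k.
  apply: cvg_big => [|k _]; first exact: add_continuous.
  apply: cvgM.
    exact: (cvg_comp _ _ (cvg_comp _ _ px gradc)
      (@coord_continuous R 1 s 0 k (gradient h x))).
  exact: (cvg_comp _ _ wv (@coord_continuous R 1 s 0 k v)).
by rewrite -dE -(diff_gradientE h x v).
Qed.

(** The one-variable mean value theorem applied to [c] mapped to [h (p + c *: v)], whose derivative
    comes from the chain rule. *)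
Lemma mvt_segment (R : realType) (s : nat) (h : 'rV[R]_s -> R)
    (p v : 'rV[R]_s) (e : R) :
  0 < e -> (forall c, 0 <= c <= e -> differentiable h (p + c *: v)) ->
  exists2 c, 0 <= c <= e & h (p + e *: v) - h p = e * 'd h (p + c *: v) v.
Proof.
move=> e0 dh.
have dphi c : 0 <= c <= e ->
    is_derive c 1 (fun c => h (p + c *: v)) ('d h (p + c *: v) v).
  move=> /dh dhc.
  have dl : is_diff c (fun c : R => p + c *: v) ( *:%R^~ v).
    by apply: is_diff_eq; rewrite add0r.
  have := is_diff_comp dl (differentiableP dhc) => dhl.
  apply: DeriveDef.
    by apply: diff_derivable; exact: ex_diff.
  rewrite -/(h \o (fun c : R => p + c *: v)) deriveE; last exact: ex_diff.
  by rewrite diff_val /= scale1r.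
have [||c cI] := @MVT R (fun c => h (p + c *: v))
    (fun c => 'd h (p + c *: v) v) 0 e e0.
- move=> c /[!in_itv]/= /andP[c0 ce]; apply: dphi; rewrite !ltW//.
- apply: derivable_within_continuous => c /[!in_itv]/= /dphi ?.
  exact: ex_derive.
rewrite scale0r addr0 subr0 => E; exists c; last by rewrite E mulrC.
by move: cI; rewrite in_itv/= => /andP[c0 ce]; rewrite !ltW.
Qed.

(* The base point, the direction and the step all vary, so that the lemma serves
   both for the segment from x and for the one from the moving point x + t d. *)
Lemma strict_differentiability (R : realType) (s : nat)
    (h : 'rV[R]_s -> R) (x v : 'rV[R]_s) (T : Type) (F : set_system T)
    {FF : Filter F} (p w : T -> 'rV[R]_s) (e : T -> R) :
  (\forall y \near x, differentiable h y) ->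
  {for x, continuous (gradient h)} ->
  p t @[t --> F] --> x -> w t @[t --> F] --> v -> e t @[t --> F] --> 0 ->
  (\forall t \near F, 0 < e t) ->
  (e t)^-1 * (h (p t + e t *: w t) - h (p t)) @[t --> F] --> 'd h x v.
Proof.
move=> dh gradc px wv e0 epos.
pose on_segment t (c : R) := 0 <= c <= e t /\
  h (p t + e t *: w t) - h (p t) = e t * 'd h (p t + c *: w t) (w t).
(* A chosen mean value point. The default 0 also lies in [[0, e t]] once [e t] is positive, so the
   squeeze to 0 needs no case where the point is known to exist. *)
pose c t : R :=
  if pselect (exists c, on_segment t c) is left E then projT1 (cid E) else 0.
have c0 : c t @[t --> F] --> 0.
  apply: (@squeeze_cvgr _ _ _ _ (fun=> 0) e) => //; last exact: cvg_cst.
  near=> t; rewrite /c; case: pselect => [E|_]; last first.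
    by rewrite lexx ltW//; near: t.
  by case: (cid E) => ? [].
have pc : p t + c t *: w t @[t --> F] --> x.
  by rewrite -[x]addr0 -(scale0r v); apply: cvgD => //; exact: cvgZ.
apply: (cvg_trans _ (cvg_diff gradc pc wv)); apply: near_eq_cvg.
(* Eventually the whole segment lies in a ball of differentiability: half the radius bounds the
   distance from [p t] to [x], the other half the length of the segment. *)
have seg : \forall t \near F, forall c, 0 <= c <= e t ->
    differentiable h (p t + c *: w t).
  have [r /= r0 rB] := (nbhs_ballP _ _).1 dh.
  have ew : e t *: w t @[t --> F] --> (0 : 'rV[R]_s).
    by rewrite -(scale0r v); exact: cvgZ.
  have r20 : 0 < r / 2 by rewrite divr_gt0.
  near=> t => k /andP[k0 ke]; apply: rB; rewrite -ball_normE/= opprD addrA.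
  apply: le_lt_trans (ler_normB _ _) _; rewrite (splitr r); apply: ltrD.
    by near: t; exact: cvgr_dist_lt px _ r20.
  have : `|0 - e t *: w t| < r / 2 by near: t; exact: cvgr_dist_lt ew _ r20.
  rewrite sub0r normrN !normrZ; apply: le_lt_trans.
  by rewrite ler_wpM2r// !ger0_norm// (le_trans k0 ke).
near=> t.
have et : 0 < e t by near: t.
have E : exists c, on_segment t c.
  have dht : forall k, 0 <= k <= e t -> differentiable h (p t + k *: w t).
    by near: t.
  have [k ? ?] := mvt_segment et dht.
  by exists k.
rewrite /c; case: pselect => // E'; case: (cid E') => /= k [_ ->].
by rewrite mulKf// gt_eqF.
Unshelve. all: by end_near. Qed.

(** * Descent of a function along a parabola *)

Definition parabola (R : realType) (s : nat) (x d z : 'rV[R]_s) (t : R) :=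
  x + t *: d + (2^-1 * t ^+ 2) *: z.

Lemma cvg_id_right0 (R : realType) : t @[t --> (0 : R)^'+] --> (0 : R).
Proof. by apply: cvg_at_right_filter; exact: cvg_id. Qed.

Lemma cvg_half_sqr (R : realType) :
  2^-1 * t ^+ 2 @[t --> (0 : R)^'+] --> (0 : R).
Proof.
have t0 := @cvg_id_right0 R.
rewrite [X in _ --> X](_ : 0 = 2^-1 * (0 * 0)); last by rewrite !mulr0.
exact: (cvgM (cvg_cst _) (cvgM t0 t0)).
Qed.

Lemma cvg_line (R : realType) (s : nat) (x d : 'rV[R]_s) :
  x + t *: d @[t --> 0^'+] --> x.
Proof.
rewrite -[X in _ --> X]addr0 -(scale0r d).
apply: cvgD; first exact: cvg_cst.
by apply: cvgZ; [exact: cvg_id_right0|exact: cvg_cst].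
Qed.

Lemma cvg_parabola (R : realType) (s : nat) (x d z : 'rV[R]_s) :
  parabola x d z t @[t --> 0^'+] --> x.
Proof.
rewrite -[X in _ --> X]addr0 -(scale0r z).
apply: cvgD; first exact: cvg_line.
by apply: cvgZ; [exact: cvg_half_sqr|exact: cvg_cst].
Qed.

Section descent.
Context {R : realType} {s : nat}.
Variables (h : 'rV[R]_s -> R) (x d z : 'rV[R]_s).
Hypothesis dh : \forall y \near x, differentiable h y.
Hypothesis gradc : {for x, continuous (gradient h)}.

(** The parabola is [x + t *: (d + (2^-1 * t) *: z)], a step of length [t] in a direction tending to
    [d], so the first-order quotient tends to the negative number ['d h x d]. *)
Lemma near_parabola_lt1 : 'd h x d < 0 ->
  \forall t \near 0^'+, h (parabola x d z t) < h x.
Proof.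
move=> hd.
have t0 := @cvg_id_right0 R.
have tpos : \forall t \near (0 : R)^'+, 0 < t by exact: nbhs_right_gt.
have half_t0 : 2^-1 * t @[t --> (0 : R)^'+] --> (0 : R).
  rewrite [X in _ --> X](_ : 0 = 2^-1 * 0); last by rewrite mulr0.
  exact: (cvgM (cvg_cst _) t0).
have wd : d + (2^-1 * t) *: z @[t --> 0^'+] --> d.
  rewrite -[X in _ --> X]addr0 -(scale0r z).
  apply: cvgD; first exact: cvg_cst.
  by apply: cvgZ; [exact: half_t0|exact: cvg_cst].
have q : t^-1 * (h (x + t *: (d + (2^-1 * t) *: z)) - h x) @[t --> 0^'+] -->
    'd h x d.
  by apply: (strict_differentiability dh gradc) wd t0 tpos; exact: cvg_cst.
have q_lt0 : \forall t \near 0^'+,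
    t^-1 * (h (x + t *: (d + (2^-1 * t) *: z)) - h x) < 0.
  exact: (cvgr_lt _ q _ hd).
near=> t; have tp : 0 < t by near: t.
have : t^-1 * (h (x + t *: (d + (2^-1 * t) *: z)) - h x) < 0 by near: t.
by rewrite pmulr_rlt0 ?invr_gt0// subr_lt0 scalerDr addrA scalerA mulrCA -expr2.
Unshelve. all: by end_near. Qed.

Lemma cvg_second_order_quotient_parabola : has_second_dir_derivative h x d ->
  2 * t ^- 2 * (h (parabola x d z t) - h x - t * 'd h x d) @[t --> 0^'+] -->
    'd h x z + second_dir_derivative h x d.
Proof.
move=> h2.
have epos : \forall t \near (0 : R)^'+, 0 < 2^-1 * t ^+ 2.
  by near=> t; rewrite mulr_gt0 ?invr_gt0// exprn_gt0.
have q : (2^-1 * t ^+ 2)^-1 *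
    (h (x + t *: d + (2^-1 * t ^+ 2) *: z) - h (x + t *: d)) @[t --> 0^'+]
    --> 'd h x z.
  apply: (strict_differentiability (w := fun=> z) dh gradc) epos.
  - exact: cvg_line.
  - exact: cvg_cst.
  - exact: cvg_half_sqr.
rewrite [X in X @ _ --> _](_ : _ = fun t => (2^-1 * t ^+ 2)^-1 *
    (h (x + t *: d + (2^-1 * t ^+ 2) *: z) - h (x + t *: d)) +
    second_order_quotient h x d t); first exact: (cvgD q h2).
apply/funext => t.
(* The identity holds for every [t], even 0, where both inverses are 0; the two values at
   [x + t *: d] cancel. *)
rewrite /second_order_quotient /parabola (invfM 2^-1) invrK -mulrDr.
by rewrite -(addrA (h (x + t *: d))) subrKA addrA.
Unshelve. all: by end_near. Qed.

(** With no first-order term, the second-order quotient is a positive multiple of the increment of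
    [h], and its limit is negative. *)
Lemma near_parabola_lt2 : 'd h x d = 0 -> has_second_dir_derivative h x d ->
  'd h x z + second_dir_derivative h x d < 0 ->
  \forall t \near 0^'+, h (parabola x d z t) < h x.
Proof.
move=> hd h2 hz; have q := cvg_second_order_quotient_parabola h2.
have q_lt0 : \forall t \near 0^'+,
    2 * t ^- 2 * (h (parabola x d z t) - h x - t * 'd h x d) < 0.
  exact: (cvgr_lt _ q _ hz).
have tpos : \forall t \near (0 : R)^'+, 0 < t by exact: nbhs_right_gt.
near=> t; have tp : 0 < t by near: t.
have : 2 * t ^- 2 * (h (parabola x d z t) - h x - t * 'd h x d) < 0 by near: t.
by rewrite hd mulr0 subr0 pmulr_rlt0 ?subr_lt0// mulr_gt0// invr_gt0 exprn_gt0.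
Unshelve. all: by end_near. Qed.

End descent.

(** * Feasible descent contradicting weak local minimality *)

Theorem theorem1 (R : realType) (s n m : nat) (X : set 'rV[R]_s)
    (f : 'I_n -> 'rV[R]_s -> R) (g : 'I_m -> 'rV[R]_s -> R)
    (xbar d : 'rV[R]_s)
    (openX : open X)
    (xbar_min : weak_local_minimizer X f g xbar)
    (d_crit : critical_direction f g xbar d)
    (g_inactive_cont : forall i, ~ active g xbar i ->
      {for xbar, continuous (g i)})
    (f_C1 : forall j, continuously_differentiable_on X (f j))
    (g_C1 : forall i, active g xbar i -> continuously_differentiable_on X (g i))
    (f_second : forall j, 'd (f j) xbar d = 0 ->
      has_second_dir_derivative (f j) xbar d)
    (g_second : forall i, active g xbar i -> 'd (g i) xbar d = 0 ->
      has_second_dir_derivative (g i) xbar d)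
    (CQ : closure (A_set X g xbar d) = B_set g xbar d) :
  ~ exists z : 'rV[R]_s,
      (forall j, J_set f xbar d j ->
        'd (f j) xbar z + second_dir_derivative (f j) xbar d < 0) /\
      (forall i, K_set g xbar d i ->
        'd (g i) xbar z + second_dir_derivative (g i) xbar d <= 0).
Proof.
move=> [z0 [fz0 gz0]].
have [[Xx gx] [U Ux no_better]] := xbar_min.
have [df dg] := d_crit.
have nearX : \forall y \near xbar, X y by exact: open_nbhs_nbhs.
have C1_near h : continuously_differentiable_on X h ->
    (\forall y \near xbar, differentiable h y) /\
    {for xbar, continuous (gradient h)}.
  by move=> hC1; split; [apply: filterS nearX => y /hC1[]|case: (hC1 _ Xx)].
have [z [Az fz]] : exists z, A_set X g xbar d z /\
    forall j, J_set f xbar d j ->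
      'd (f j) xbar z + second_dir_derivative (f j) xbar d < 0.
  have clz0 : closure (A_set X g xbar d) z0 by rewrite CQ.
  have near_fz j : J_set f xbar d j -> \forall z \near z0,
      'd (f j) xbar z + second_dir_derivative (f j) xbar d < 0.
    move=> Jj; have [_ gradc] := f_C1 j _ Xx.
    have q : 'd (f j) xbar z + second_dir_derivative (f j) xbar d @[z --> z0]
        --> 'd (f j) xbar z0 + second_dir_derivative (f j) xbar d.
      apply: (@cvgD _ _ _ (nbhs z0)); last exact: cvg_cst.
      apply: (cvg_diff (p := fun=> xbar) gradc).
        exact: cvg_cst.
      exact: cvg_id.
    exact: (cvgr_lt _ q _ (fz0 j Jj)).
  (* There are finitely many indices [j], so the neighbourhoods of [z0] intersect in one, which
     meets [A_set]. *)
  have /clz0[z [Az fz]] : \forall z \near z0, forall j, J_set f xbar d j ->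
      'd (f j) xbar z + second_dir_derivative (f j) xbar d < 0.
    apply: (@filter_forall _ _ _ (nbhs z0)) => j.
    have [/near_fz|nJj] := pselect (J_set f xbar d j); last exact: nearW.
    by apply: filterS.
  by exists z.
have c_cvg := @cvg_parabola _ _ xbar d z.
have f_lt : \forall t \near 0^'+, forall j,
    f j (parabola xbar d z t) < f j xbar.
  apply: (@filter_forall _ _ _ 0^'+) => j; have [dfn fc] := C1_near _ (f_C1 j).
  (* Criticality leaves two cases: a zero slope, settled by the choice of [z], or a negative one. *)
  have [/eqP dfj|/negbTE dfj] := boolP ('d (f j) xbar d == 0).
    exact: near_parabola_lt2 dfn fc dfj (f_second j dfj) (fz j dfj).
  by apply: near_parabola_lt1 => //; rewrite lt_neqAle dfj df.
have g_le : \forall t \near 0^'+, forall i, g i (parabola xbar d z t) <= 0.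
  apply: (@filter_forall _ _ _ 0^'+) => i.
  have [gi|gi] := pselect (active g xbar i); last first.
    have gi0 : g i xbar < 0 by rewrite lt_neqAle gx andbT; exact/eqP.
    have q := cvg_comp _ _ c_cvg (g_inactive_cont i gi).
    have : \forall t \near 0^'+, g i (parabola xbar d z t) < 0.
      exact: (cvgr_lt _ q _ gi0).
    by apply: filterS => t /ltW.
  have [/eqP dgi|/negbTE dgi] := boolP ('d (g i) xbar d == 0).
    have [delta delta0 gA] := Az i (conj gi dgi).
    (* The point tested in [A_set] is the parabola by unfolding. *)
    near=> t; have [|_] := gA t; last exact.
    by apply/andP; split; near: t; [exact: nbhs_right_gt|exact: nbhs_right_lt].
  have [dgn gc] := C1_near _ (g_C1 i gi).
  have : \forall t \near 0^'+, g i (parabola xbar d z t) < g i xbar.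
    by apply: near_parabola_lt1 => //; rewrite lt_neqAle dgi dg.
  by apply: filterS => t; rewrite gi => /ltW.
(* Membership in [X] is taken from openness, which also covers an empty [K_set]. *)
have c_in : \forall t \near 0^'+, (U `&` X) (parabola xbar d z t).
  have UX : nbhs xbar (U `&` X) by exact: filterI.
  exact: (c_cvg _ UX).
near (0 : R)^'+ => t.
apply: no_better; exists (parabola xbar d z t); last by near: t.
have [Ut Xt] : (U `&` X) (parabola xbar d z t) by near: t.
by split=> //; split=> //; near: t.
Unshelve. all: by end_near. Qed.
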